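(* The category $\mathbf{PZLC}$ of all locally compact zero-dimensional Hausdorff spaces and all perfect maps between them is dually equivalent to the category $\mathbf{PZLBA}$.
   Context: Zero-dimensional means having a base of clopen sets. A map is perfect if it is continuous, closed and has compact point-inverses (it need not be onto). A local Boolean algebra (LBA) is a pair $(A,I)$ where $A$ is a Boolean algebra ($0=1$ allowed) and $I$ is an ideal of $A$ (possibly $I=A$) which is dense in $A$, i.e. for every $a\in A\setminus\{0\}$ there is $b\in I\setminus\{0\}$ with $b\le a$. For an LBA $(B,I)$, an ideal $J$ of $I$ is a (nonempty) lower subset of $I$ closed under finite joins. Put $\neg J=\{a\in I\mid a\wedge b=0\text{ for all }b\in J\}$. The ideal $J$ is simple if $J\vee\neg J=I$ in the lattice of ideals of $I$, i.e. every element of $I$ is the join of an element of $J$ and an element of $\neg J$. $Si(I)$ denotes the set of simple ideals of $I$. An LBA $(B,I)$ is a ZLB-algebra (ZLBA) if for every $J\in Si(I)$ the join $\bigvee_B J$ exists in $B$. $\mathbf{PZLBA}$ is the category whose objects are all ZLBAs and whose morphisms $\varphi:(A,I)\to(B,J)$ are all Boolean homomorphisms $\varphi:A\to B$ such that (LBA) for every $b\in J$ there exists $a\in I$ with $b\le\varphi(a)$, and (PLBA) $\varphi(I)\subseteq J$; composition and identities are the usual ones of functions. Two categories are dually equivalent if one is equivalent to the opposite of the other. *)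

(* Defs.v *)
From HB Require Import structures.
From mathcomp Require Import all_boot all_order.
From mathcomp Require Import boolp classical_sets topology.

Set Implicit Arguments.
Unset Strict Implicit.
Unset Printing Implicit Defensive.

Import Order.TTheory.

Local Open Scope classical_set_scope.

Record category := Category {
  obj :> Type;
  hom : obj -> obj -> Type;
  idm : forall x, hom x x;
  compm : forall x y z, hom y z -> hom x y -> hom x z;
  compm_idl : forall x y (f : hom x y), compm (idm y) f = f;
  compm_idr : forall x y (f : hom x y), compm f (idm x) = f;
  compm_assoc : forall x y z t (h : hom z t) (g : hom y z) (f : hom x y),
    compm h (compm g f) = compm (compm h g) f }.

Arguments hom {c} x y.
Arguments idm {c} x.
Arguments compm {c x y z} g f.

Definition opposite (C : category) : category :=
  {| obj := C;
     hom x y := @hom C y x;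
     idm x := @idm C x;
     compm _ _ _ g f := @compm C _ _ _ f g;
     compm_idl _ _ f := @compm_idr C _ _ f;
     compm_idr _ _ f := @compm_idl C _ _ f;
     compm_assoc _ _ _ _ h g f := esym (@compm_assoc C _ _ _ _ f g h) |}.

Record functor (C D : category) := Functor {
  fobj :> C -> D;
  fmor : forall x y : C, hom x y -> hom (fobj x) (fobj y);
  fmor_id : forall x : C, fmor (idm x) = idm (fobj x);
  fmor_comp : forall (x y z : C) (g : hom y z) (f : hom x y),
    fmor (compm g f) = compm (fmor g) (fmor f) }.

Arguments fmor {C D} _ {x y}.

Definition id_functor (C : category) : functor C C :=
  {| fobj x := x;
     fmor _ _ f := f;
     fmor_id _ := erefl;
     fmor_comp _ _ _ _ _ := erefl |}.

Definition comp_functor (C D E : category) (G : functor D E) (F : functor C D) :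
    functor C E.
Proof.
exists (fun x => G (F x)) (fun x y f => fmor G (fmor F f)).
- by move=> x; rewrite !fmor_id.
- by move=> x y z g f; rewrite !fmor_comp.
Defined.

Definition is_iso (C : category) (x y : C) (f : hom x y) : Prop :=
  exists g : hom y x, compm g f = idm x /\ compm f g = idm y.

Definition naturally_isomorphic (C D : category) (F G : functor C D) : Prop :=
  exists eta : forall x : C, hom (F x) (G x),
    (forall x, is_iso (eta x)) /\
    (forall (x y : C) (f : hom x y),
       compm (eta y) (fmor F f) = compm (fmor G f) (eta x)).

Definition equivalent (C D : category) : Prop :=
  exists (F : functor C D) (G : functor D C),
    naturally_isomorphic (comp_functor G F) (id_functor C) /\
    naturally_isomorphic (comp_functor F G) (id_functor D).

Definition dually_equivalent (C D : category) : Prop :=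
  equivalent C (opposite D).

Lemma sig_inj (T : Type) (P : T -> Prop) (u v : {x : T | P x}) :
  sval u = sval v -> u = v.
Proof. by move=> uv; apply: eq_sig_hprop => // x; exact: Prop_irrelevance. Qed.

Arguments sig_inj {T P u v} & _.

(* Not the library's [zero_dimensional], which only asks that distinct points
   be separated by a clopen set. *)
Definition has_clopen_base (X : topologicalType) : Prop :=
  exists2 B : set (set X), basis B & B `<=` clopen.

Definition perfect_map (X Y : topologicalType) (f : X -> Y) : Prop :=
  [/\ continuous f,
      forall A : set X, closed A -> closed (f @` A) &
      forall y : Y, compact (f @^-1` [set y])].

Lemma perfect_map_id (X : topologicalType) : perfect_map (@idfun X).
Proof.
split=> [x //|A|y]; first by rewrite image_id.
exact: compact_set1.
Qed.

Lemma perfect_map_preimage_compact (X Y : topologicalType) (f : X -> Y)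
  (K : set Y) : perfect_map f -> compact K -> compact (f @^-1` K).
Proof.
move=> [_ fcl fK] cK F FF FK.
have [y [Ky Fy]] := cK (f @ F) _ FK.
have meet A : F A -> (closure A `&` f @^-1` [set y]) !=set0.
  move=> FA; suff [x Ax fxy] : (f @` closure A) y by exists x.
  apply: (fcl _ (@closed_closure _ A)) => U Uy.
  suff FfA : F (f @^-1` (f @` closure A)) by exact: (Fy _ U FfA Uy).
  by apply: filterS FA => x Ax; exists x => //; exact: subset_closure.
pose G := filter_from F (fun A => closure A `&` f @^-1` [set y]).
have GF : ProperFilter G.
  apply: filter_from_proper => //; apply: filter_from_filter.
    by exists setT; exact: filterT.
  move=> A B FA FB; exists (A `&` B); first exact: filterI.
  by move=> x [clx fx]; split; split=> //; apply: closureS clx => z [].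
have [|x [fx Gx]] := fK y G GF.
  by exists setT; [exact: filterT|move=> x []].
exists x; split; first by rewrite /preimage/= fx.
move=> A U FA; apply: (@closed_closure _ A) => V Vx.
by apply: Gx Vx; exists A => // z [].
Qed.

Lemma perfect_map_comp (X Y Z : topologicalType) (g : Y -> Z) (f : X -> Y) :
  perfect_map g -> perfect_map f -> perfect_map (g \o f).
Proof.
move=> [gc gcl gK] pf; have [fc fcl _] := pf; split.
- by move=> x; apply: continuous_comp; [exact: fc|exact: gc].
- by move=> A /fcl/gcl; rewrite image_comp.
- by move=> z; rewrite comp_preimage; exact: perfect_map_preimage_compact.
Qed.

Record pzlc_space := PZLCSpace {
  space :> topologicalType;
  space_lc : locally_compact [set: space];
  space_zd : has_clopen_base space;
  space_haus : hausdorff_space space }.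

Definition PZLC : category :=
  {| obj := pzlc_space;
     hom X Y := {f : X -> Y | perfect_map f};
     idm X := exist _ idfun (perfect_map_id X);
     compm _ _ _ g f :=
       exist _ (sval g \o sval f) (perfect_map_comp (svalP g) (svalP f));
     compm_idl _ _ _ := sig_inj erefl;
     compm_idr _ _ _ := sig_inj erefl;
     compm_assoc _ _ _ _ _ _ _ := sig_inj erefl |}.

Section LocalBooleanAlgebras.
Variables (d : Order.disp_t) (A : ctbDistrLatticeType d).

(* [ideal_of setT I] says that [I] is an ideal of the Boolean algebra [A]. *)
Definition ideal_of (I J : set A) : Prop :=
  [/\ J `<=` I,
      J !=set0,
      forall a b, I a -> J b -> (a <= b)%O -> J a &
      forall a b, J a -> J b -> J (a `|` b)%O].

Definition dense_ideal (I : set A) : Prop :=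
  forall a : A, a <> \bot%O ->
    exists b, [/\ I b, b <> \bot%O & (b <= a)%O].

Definition is_LBA (I : set A) : Prop := ideal_of setT I /\ dense_ideal I.

Definition neg_ideal (I J : set A) : set A :=
  [set a | I a /\ forall b, J b -> (a `&` b)%O = \bot%O].

Definition simple_ideal (I J : set A) : Prop :=
  ideal_of I J /\
  forall a, I a -> exists b c, [/\ J b, neg_ideal I J c & a = (b `|` c)%O].

Definition is_ZLBA (I : set A) : Prop :=
  is_LBA I /\ forall J, simple_ideal I J -> exists s, isLub J s.

End LocalBooleanAlgebras.

Definition boolean_hom (d d' : Order.disp_t) (A : ctbDistrLatticeType d)
    (B : ctbDistrLatticeType d') (phi : A -> B) : Prop :=
  [/\ phi \bot%O = \bot%O,
      phi \top%O = \top%O,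
      forall a b, phi (a `&` b)%O = (phi a `&` phi b)%O,
      forall a b, phi (a `|` b)%O = (phi a `|` phi b)%O &
      forall a, phi (~` a)%O = (~` (phi a))%O].

Record zlba := ZLBA {
  zlba_disp : Order.disp_t;
  zlba_alg :> ctbDistrLatticeType zlba_disp;
  zlba_ideal : set zlba_alg;
  zlbaP : is_ZLBA zlba_ideal }.

Definition pzlba_hom (A B : zlba) (phi : A -> B) : Prop :=
  [/\ boolean_hom phi,
      forall b, zlba_ideal b -> exists2 a, zlba_ideal a & (b <= phi a)%O &
      forall a, zlba_ideal a -> zlba_ideal (phi a)].

Lemma pzlba_hom_id (A : zlba) : pzlba_hom (@idfun A).
Proof. by split=> // b Ib; exists b. Qed.

Lemma pzlba_hom_comp (A B C : zlba) (psi : B -> C) (phi : A -> B) :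
  pzlba_hom psi -> pzlba_hom phi -> pzlba_hom (psi \o phi).
Proof.
move=> [[psi0 psi1 psiI psiU psiC] psiL psiP].
move=> [[phi0 phi1 phiI phiU phiC] phiL phiP].
split; first split=> /=.
- by rewrite phi0.
- by rewrite phi1.
- by move=> a b; rewrite phiI psiI.
- by move=> a b; rewrite phiU psiU.
- by move=> a; rewrite phiC psiC.
- move=> c /psiL[b /phiL[a Ia ba] cb]; exists a => //=.
  by apply: le_trans cb _; rewrite leEmeet -psiI (meet_l ba).
- by move=> a /phiP/psiP.
Qed.

Definition PZLBA : category :=
  {| obj := zlba;
     hom A B := {phi : A -> B | pzlba_hom phi};
     idm A := exist _ idfun (pzlba_hom_id A);
     compm _ _ _ psi phi :=
       exist _ (sval psi \o sval phi) (pzlba_hom_comp (svalP psi) (svalP phi));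
     compm_idl _ _ _ := sig_inj erefl;
     compm_idr _ _ _ := sig_inj erefl;
     compm_assoc _ _ _ _ _ _ _ := sig_inj erefl |}.

(* Main.v *)
(* Stone duality. A space X is sent to the algebra of its clopen sets, with the
   ideal of the compact ones; for a simple ideal J of compact clopen sets the
   union of J is clopen, because its complement is the union of the negation of
   J. An algebra (A, I) is sent to the space of the ultrafilters of A that meet
   I, with the sets s(a) of the ultrafilters containing a as a base; s(a) is
   compact for a in I. Density of I makes s injective. For a clopen set U, the a
   in I with s(a) contained in U form a simple ideal, whose join m satisfies
   s(m) = U: this is where the ZLB condition makes s surjective. *)
Require Import Defs.
From HB Require Import structures.
From mathcomp Require Import all_boot all_order.
From mathcomp Require Import boolp classical_sets filter topology.

Set Implicit Arguments.
Unset Strict Implicit.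
Unset Printing Implicit Defensive.

Import Order.TTheory Order.CTheory.

Local Open Scope classical_set_scope.

(** * Compactness, homeomorphisms and compact clopen neighbourhoods *)

Lemma perfect_map_continuous (X Y : topologicalType) (f : X -> Y) :
  perfect_map f -> continuous f.
Proof. by case. Qed.

Lemma continuous_image_compact (X Y : topologicalType) (f : X -> Y)
  (K : set X) : continuous f -> compact K -> compact (f @` K).
Proof.
by move=> fc; apply: continuous_compact; exact: continuous_subspaceT.
Qed.

Lemma homeomorphism_perfect (X Y : topologicalType) (f : X -> Y) (g : Y -> X) :
  continuous f -> continuous g -> cancel f g -> cancel g f -> perfect_map f.
Proof.
move=> fc gc fK gK.
have imE (A : set X) : f @` A = g @^-1` A.
  apply/seteqP; split=> [_ [x Ax <-]|y Agy]; first by rewrite /preimage/= fK.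
  by exists (g y).
split=> // [A Acl|y].
  by rewrite imE; apply: preimage_closed.
suff -> : f @^-1` [set y] = [set g y] by exact: compact_set1.
by apply/seteqP; split=> x /= => [<-|->].
Qed.

(** A basic clopen set inside both [U] and a compact neighbourhood of [x] is closed in a compact
    set, hence compact. *)
Lemma compact_clopen_nbhs (X : pzlc_space) (x : X) (U : set X) : nbhs x U ->
  exists K, [/\ clopen K, compact K, K x & K `<=` U].
Proof.
move=> xU; have [B [_ Bx] Bcl] := space_zd X.
have [C] := @space_lc X x Logic.I.
rewrite /within/= => xC [Cc _].
have [|K [BK Kx] KCU] := Bx x (C `&` U).
  by apply: filterI => //; apply: filterS xC => y; exact.
exists K; split=> //; first exact: Bcl.
- apply: subclosed_compact Cc _; first by have [] := Bcl _ BK.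
  by move=> y /KCU[].
- by move=> y /KCU[].
Qed.

(** If no [F i] contained [C], directedness would make the sets [C \ F i] a base of a proper filter;
    a cluster point of it in [C] has some [F i] as a neighbourhood, which would have to meet
    [C \ F i]. *)
Lemma compact_directed_cover (T : topologicalType) (I : Type) (D : set I)
    (F : I -> set T) (C : set T) : compact C -> D !=set0 ->
    (forall i j, D i -> D j -> exists2 k, D k & F i `|` F j `<=` F k) ->
    (forall x, C x -> exists2 i, D i & nbhs x (F i)) ->
  exists2 i, D i & C `<=` F i.
Proof.
move=> Cc [i0 Di0] Fdir Fcov; apply: contrapT => nF.
pose G := filter_from D (fun i => C `\` F i).
have GF : ProperFilter G.
  apply: filter_from_proper => [|i Di].
    apply: filter_from_filter => [|i j Di Dj]; first by exists i0.
    have [k Dk Fk] := Fdir i j Di Dj; exists k => // x [Cx nFx].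
    by split; split=> // ?; apply/nFx/Fk; [left|right].
  apply: contrapT => /nonemptyPn CF.
  by apply: nF; exists i => //; rewrite -setD_eq0.
have [|x [Cx Gx]] := Cc G GF; first by exists i0 => // x [].
have [i Di Fx] := Fcov x Cx.
have [|y [[_ nFy] //]] := Gx (C `\` F i) (F i) _ Fx.
by exists i.
Qed.

(** The compact clopen sets form a directed cover of the space. This is the source of condition
    (LBA) for preimage maps. *)
Lemma compact_clopen_cover (X : pzlc_space) (C : set X) : compact C ->
  exists K, [/\ clopen K, compact K & C `<=` K].
Proof.
move=> Cc.
have [||K L [Kcl Kc] [Lcl Lc]|x _|K [Kcl Kc] CK] :=
  @compact_directed_cover X _ [set K | clopen K /\ compact K] id C.
- exact: Cc.
- by exists set0; split; [exact: clopen0|exact: compact0].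
- by exists (K `|` L) => //; split; [exact: clopenU|exact: compactU].
- have [K [Kcl Kc Kx _]] := compact_clopen_nbhs (@filterT _ _ (nbhs_filter x)).
  by exists K => //; exact: open_nbhs_nbhs (conj Kcl.1 Kx).
- by exists K.
Qed.

(** * The Boolean algebra of clopen sets and its ideal of compact ones *)

Section ClopenAlgebra.
Variable X : topologicalType.

Definition clopens := {U : set X | clopen U}.

HB.instance Definition _ := gen_eqMixin clopens.
HB.instance Definition _ := gen_choiceMixin clopens.

Implicit Types U V W : clopens.

Let meet U V : clopens := exist _ _ (clopenI (svalP U) (svalP V)).
Let join U V : clopens := exist _ _ (clopenU (svalP U) (svalP V)).
Let compl U : clopens := exist _ _ (clopenC set0 (svalP U)).
Let le U V := `[< sval U `<=` sval V >].

Let le_def U V : le U V = (meet U V == U).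
Proof.
apply/asboolP/eqP => [UV|/(congr1 sval)/= UV]; last exact/setIidPl.
by apply: sig_inj; exact/setIidPl.
Qed.

Fact clopens_display : Order.disp_t. Proof. by []. Qed.

HB.instance Definition _ :=
  @Order.isMeetJoinDistrLattice.Build clopens_display clopens
    le (fun U V => (V != U) && le U V) meet join le_def (fun _ _ => erefl)
    (fun _ _ => sig_inj (setIC _ _)) (fun _ _ => sig_inj (setUC _ _))
    (fun _ _ _ => sig_inj (setIA _ _ _)) (fun _ _ _ => sig_inj (setUA _ _ _))
    (fun _ _ => sig_inj (SetOrder.Internal.joinKI _ _))
    (fun _ _ => sig_inj (SetOrder.Internal.meetKU _ _))
    (fun _ _ _ => sig_inj (setIUl _ _ _)) (fun _ => sig_inj (setIid _)).

Lemma clopens_leP U V : reflect (sval U `<=` sval V) (U <= V)%O.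
Proof. exact: asboolP. Qed.

Let bottom : clopens := exist _ _ clopen0.
Let top : clopens := exist _ _ clopenT.

Let bottom_le U : (bottom <= U)%O.
Proof. exact/clopens_leP. Qed.

Let le_top U : (U <= top)%O.
Proof. exact/clopens_leP. Qed.

HB.instance Definition _ :=
  Order.hasBottom.Build clopens_display clopens bottom_le.
HB.instance Definition _ :=
  Order.hasTop.Build clopens_display clopens le_top.
HB.instance Definition _ :=
  Order.TBDistrLattice_hasComplement.Build clopens_display clopens
    (fun U => sig_inj (setUCr (sval U)) : (U `|` compl U)%O = \top%O)
    (fun U => sig_inj (setICr (sval U)) : (U `&` compl U)%O = \bot%O).

Definition compact_clopens : set clopens := [set U | compact (sval U)].

End ClopenAlgebra.

Lemma compact_clopens_ideal (X : topologicalType) :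
  ideal_of setT (@compact_clopens X).
Proof.
split=> //.
- by exists \bot%O; exact: compact0.
- move=> U V _ Vc /clopens_leP UV; apply: subclosed_compact Vc UV.
  by have [] := svalP U.
- by move=> U V; exact: compactU.
Qed.

(** Simplicity splits a compact clopen neighbourhood of any point into a member of [J] and a member
    of the negation of [J], so the unions of these two ideals cover the space. They are disjoint and
    both open. *)
Lemma simple_ideal_clopen_union (X : pzlc_space) (J : set (clopens X)) :
  simple_ideal (@compact_clopens X) J -> clopen (\bigcup_(U in J) sval U).
Proof.
move=> [_ JnegJ].
split; first by apply: bigcup_open => U _; have [] := svalP U.
suff -> : \bigcup_(U in J) sval U =
          ~` \bigcup_(U in neg_ideal (@compact_clopens X) J) sval U.
  by apply: open_closedC; apply: bigcup_open => U _; have [] := svalP U.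
apply/seteqP; split=> [x [U JU Ux] [V [_ UV] Vx]|x nx].
  have : sval (V `&` U)%O x by split.
  by rewrite UV.
have [K [Kcl Kc Kx _]] := compact_clopen_nbhs (@filterT _ _ (nbhs_filter x)).
have [U [V [JU JV /(congr1 sval)/= KUV]]] := JnegJ (exist _ K Kcl) Kc.
by move: Kx; rewrite KUV => -[Ux|Vx]; [exists U|case: nx; exists V].
Qed.

(** Density comes from a compact clopen neighbourhood of a point of a nonempty clopen set; the join
    of a simple ideal is its union. *)
Lemma compact_clopens_ZLBA (X : pzlc_space) : is_ZLBA (@compact_clopens X).
Proof.
split.
  split; first exact: compact_clopens_ideal.
  move=> U U0.
  have [x Ux] : sval U !=set0.
    by apply: contrapT => /nonemptyPn U0'; apply: U0; exact: sig_inj.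
  have [K [Kcl Kc Kx KU]] :=
    compact_clopen_nbhs (open_nbhs_nbhs (conj (svalP U).1 Ux)).
  exists (exist _ K Kcl); split=> //; last exact/clopens_leP.
  by move=> /(congr1 sval)/= K0; rewrite K0 in Kx.
move=> J Js; exists (exist _ _ (simple_ideal_clopen_union Js)); split.
  by move=> U JU; apply/clopens_leP => x Ux; exists U.
by move=> V JV; apply/clopens_leP => x [U /JV/clopens_leP]; exact.
Qed.

(** * The functor from spaces to algebras *)

Definition clopen_zlba (X : pzlc_space) : zlba :=
  ZLBA (compact_clopens_ZLBA X).

Definition clopen_preimage (X Y : topologicalType) (f : X -> Y)
    (fc : continuous f) (U : clopens Y) : clopens X :=
  exist _ _ (preimage_clopen (svalP U) fc).

(** For (LBA), the image of a compact clopen set is compact and so lies in a compact clopen set [K],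
    whose preimage contains the original set. (PLBA) holds since perfect maps pull compact sets back
    to compact sets. *)
Lemma clopen_preimage_pzlba_hom (X Y : pzlc_space) (f : X -> Y)
  (pf : perfect_map f) :
  @pzlba_hom (clopen_zlba Y) (clopen_zlba X)
    (clopen_preimage (perfect_map_continuous pf)).
Proof.
split.
- by split=> *; exact: sig_inj.
- move=> U Uc; have fc := perfect_map_continuous pf.
  have [K [Kcl Kc fUK]] :=
    compact_clopen_cover (continuous_image_compact fc Uc).
  exists (exist _ K Kcl) => //; apply/clopens_leP => x Ux /=.
  by apply: fUK; exists x.
- by move=> U Uc; exact: perfect_map_preimage_compact.
Qed.

Definition clopen_functor : functor PZLC (opposite PZLBA).
Proof.
exists (fun X : PZLC => clopen_zlba X : opposite PZLBA)
  (fun X Y f => exist _ _ (clopen_preimage_pzlba_hom (svalP f))).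
- by move=> X; apply: sig_inj; apply/funext => U; exact: sig_inj.
- by move=> X Y Z g f; apply: sig_inj; apply/funext => U; exact: sig_inj.
Defined.

(** * Ultrafilters of a Boolean algebra *)

Section BooleanUltrafilters.
Variables (d : Order.disp_t) (A : ctbDistrLatticeType d).
Implicit Types (a b : A) (u : set A).

Definition boolean_filter u : Prop :=
  [/\ ~ u \bot%O,
      forall a b, u a -> (a <= b)%O -> u b &
      forall a b, u a -> u b -> u (a `&` b)%O].

Definition boolean_ultrafilter u : Prop :=
  boolean_filter u /\ forall a, u a \/ u (~` a)%O.

Lemma boolean_ultrafilter_exists b : b <> \bot%O ->
  exists2 u, boolean_ultrafilter u & u b.
Proof.
move=> b0.
(* The second clause lets the empty chain be bounded by the empty set. *)
pose P := [set u | boolean_filter u /\ (u !=set0 -> u b)].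
have [F FP Ftot|u [[[u0 uS uI] ub] umax]] := @Zorn_bigcup A P.
  split; last first.
    by move=> [a [u Fu ua]]; exists u => //; apply: (FP u Fu).2; exists a.
  split.
  - by move=> [u /FP[[u0 _ _] _] /u0].
  - move=> a c [u Fu ua] ac; exists u => //.
    by have [[_ uS _] _] := FP u Fu; exact: uS ac.
  - move=> a c [u Fu ua] [v Fv vc].
    have [uv|vu] := Ftot u v Fu Fv.
      exists v => //; have [[_ _ vI] _] := FP v Fv.
      by apply: vI => //; exact: uv.
    exists u => //; have [[_ _ uI] _] := FP u Fu.
    by apply: uI => //; exact: vu.
(* If [b] were not in [u], then [u] would be empty, and the principal filter of [b] would strictly
   extend it. *)
have {}ub : u b.
  apply: contrapT => nub; apply: (umax [set a | (b <= a)%O]).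
    split; first by move=> a ua; case: nub; apply: ub; exists a.
    by move=> /(_ b (lexx b)).
  split; last by move=> _; exact: lexx.
  split.
  - by rewrite /= lex0 => /eqP.
  - by move=> a c /= ba; exact: le_trans.
  - by move=> a c /= ba bc; rewrite lexI ba bc.
exists u => //; split=> // a; apply: contrapT => /not_orP[nua nuca].
(* This is the filter generated by [u] and [a]. It is proper: [x] meeting [a] in bottom would give
   [x] below the complement of [a], which is not in [u]. *)
apply: (umax [set c | exists2 x, u x & (x `&` a <= c)%O]).
  split; first by move=> x ux; exists x => //; exact: leIl.
  by move=> /(_ a) ua; apply/nua/ua; exists b => //; exact: leIr.
split; last by move=> _; exists b => //; exact: leIl.
split.
- move=> [x ux]; rewrite lex0 disj_leC => xa.
  by apply: nuca; exact: uS ux xa.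
- by move=> c e [x ux xc] ce; exists x => //; exact: le_trans ce.
- move=> c e [x ux xc] [y uy ye]; exists (x `&` y)%O; first exact: uI.
  by rewrite lexI (le_trans _ xc) ?(le_trans _ ye) ?leI2 ?leIl ?leIr.
Qed.

Section Operations.
Variable u : set A.
Hypothesis uu : boolean_ultrafilter u.

Lemma boolean_ultrafilter_le a b : (a <= b)%O -> u a -> u b.
Proof. by have [[_ uS _] _] := uu; move=> ab ua; exact: uS ab. Qed.

Lemma boolean_ultrafilter0 : ~ u \bot%O.
Proof. by have [[]] := uu. Qed.

Lemma boolean_ultrafilter1 : u \top%O.
Proof.
by have [_ /(_ \top%O)[//|]] := uu; apply: boolean_ultrafilter_le; exact: lex1.
Qed.

Lemma boolean_ultrafilterI a b : u (a `&` b)%O <-> u a /\ u b.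
Proof.
split=> [uab|[ua ub]]; last by have [[_ _ uI] _] := uu; exact: uI.
by split; apply: boolean_ultrafilter_le uab; [exact: leIl|exact: leIr].
Qed.

Lemma boolean_ultrafilterC a : u (~` a)%O <-> ~ u a.
Proof.
split=> [uca ua|]; last by have [_ /(_ a)[]] := uu.
by apply: boolean_ultrafilter0; rewrite -(meetxC a); apply/boolean_ultrafilterI.
Qed.

Lemma boolean_ultrafilterU a b : u (a `|` b)%O <-> u a \/ u b.
Proof.
split=> [uab|[]]; last 2 first.
- by apply: boolean_ultrafilter_le; exact: leUl.
- by apply: boolean_ultrafilter_le; exact: leUr.
apply: contrapT.
move=> /not_orP[/boolean_ultrafilterC uca /boolean_ultrafilterC ucb].
have /boolean_ultrafilterI := conj uca ucb.
by rewrite -complU => /boolean_ultrafilterC.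
Qed.

End Operations.

End BooleanUltrafilters.

(** * The Stone space of a ZLBA *)

Section StoneSpace.
Variable A : zlba.
Implicit Types a b i : A.

Local Notation I := (@zlba_ideal A).

Definition stone_space :=
  {u : set A | boolean_ultrafilter u /\ exists2 i, I i & u i}.

Implicit Types u v : stone_space.

Definition stone_set a : set stone_space := [set u | sval u a].

Lemma stone_set0 : stone_set \bot%O = set0.
Proof.
by apply/seteqP; split=> // u; exact: (boolean_ultrafilter0 (svalP u).1).
Qed.

Lemma stone_set1 : stone_set \top%O = setT.
Proof.
by apply/seteqP; split=> // u _; exact: (boolean_ultrafilter1 (svalP u).1).
Qed.

Lemma stone_setI a b : stone_set (a `&` b)%O = stone_set a `&` stone_set b.
Proof.
by apply/seteqP; split=> u /(boolean_ultrafilterI (svalP u).1).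
Qed.

Lemma stone_setU a b : stone_set (a `|` b)%O = stone_set a `|` stone_set b.
Proof.
by apply/seteqP; split=> u /(boolean_ultrafilterU (svalP u).1).
Qed.

Lemma stone_setC a : stone_set (~` a)%O = ~` stone_set a.
Proof.
by apply/seteqP; split=> u /(boolean_ultrafilterC (svalP u).1).
Qed.

(** If [a] is not below [b], density gives a nonzero [i] in [I] below [a] and below the complement
    of [b]. An ultrafilter containing [i] meets [I], so it is a point of [stone_set a] outside
    [stone_set b]. *)
Lemma stone_set_subset a b : stone_set a `<=` stone_set b <-> (a <= b)%O.
Proof.
split=> [ab|ab u]; last exact: (boolean_ultrafilter_le (svalP u).1 ab).
apply: contrapT => nab.
have [|i [Ii i0]] := (zlbaP A).1.2 (a `&` ~` b)%O.
  by move/eqP; rewrite disj_leC complK.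
rewrite lexI => /andP[ia ib].
have [u uu ui] := boolean_ultrafilter_exists i0.
pose p : stone_space := exist _ u (conj uu (ex_intro2 _ _ i Ii ui)).
have /ab : stone_set a p by exact: (boolean_ultrafilter_le uu ia).
have : stone_set (~` b)%O p by exact: (boolean_ultrafilter_le uu ib).
by rewrite stone_setC.
Qed.

Lemma stone_set_inj : injective stone_set.
Proof.
move=> a b ab; apply/eqP; rewrite eq_le.
by apply/andP; split; apply/stone_set_subset; rewrite ab.
Qed.

HB.instance Definition _ := gen_eqMixin stone_space.
HB.instance Definition _ := gen_choiceMixin stone_space.

Let op : set_system stone_space :=
  [set U | forall u, U u -> exists2 a, sval u a & stone_set a `<=` U].

Let opT : op setT.
Proof. by move=> u _; have [_ [i _ ui]] := svalP u; exists i. Qed.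

Let opI : setI_closed op.
Proof.
move=> U V Uop Vop u [/Uop[a ua aU] /Vop[b ub bV]]; exists (a `&` b)%O.
  exact/(boolean_ultrafilterI (svalP u).1).
by rewrite stone_setI; exact: setISS.
Qed.

Let op_bigU (J : Type) (F : J -> set stone_space) :
  (forall j, op (F j)) -> op (\bigcup_j F j).
Proof.
move=> Fop u [j _ /Fop[a ua aF]]; exists a => //.
by apply: subset_trans aF _; exact: bigcup_sup.
Qed.

HB.instance Definition _ := isOpenTopological.Build stone_space opT opI op_bigU.

Lemma stone_nbhsP u (U : set stone_space) :
  nbhs u U <-> exists2 a, sval u a & stone_set a `<=` U.
Proof.
split=> [[V [Vop /Vop[a ua aV] VU]]|[a ua aU]].
  by exists a => //; exact: subset_trans VU.
by exists (stone_set a); split=> // v va; exists a.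
Qed.

Lemma stone_set_clopen a : clopen (stone_set a).
Proof.
have op_s b : open (stone_set b) by move=> u ub; exists b.
split=> //; rewrite -(complK a) stone_setC.
exact: open_closedC.
Qed.

(* An ultrafilter of sets on the Stone space containing [stone_set a] converges
   to its trace on the algebra, which is a point because it contains [a]. *)
Lemma stone_set_compact a : I a -> compact (stone_set a).
Proof.
move=> Ia; rewrite compact_ultra => F FU Fa.
pose w := [set b | F (stone_set b)].
have wu : boolean_ultrafilter w.
  split; first split.
  - by rewrite /w/= stone_set0; exact: filter_not_empty.
  - by move=> b c wb /stone_set_subset; move/filterS; exact.
  - by move=> b c wb wc; rewrite /w/= stone_setI; exact: filterI.
  - by move=> b; rewrite /w/= stone_setC; exact: in_ultra_setVsetC.
exists (exist _ w (conj wu (ex_intro2 _ _ a Ia Fa))); split=> //.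
by move=> U /stone_nbhsP[b wb bU]; exact: filterS bU _.
Qed.

Lemma stone_space_locally_compact : locally_compact [set: stone_space].
Proof.
move=> u _; have [_ [i Ii ui]] := svalP u; exists (stone_set i).
  by apply/stone_nbhsP; exists i.
by split; [exact: stone_set_compact|have [] := stone_set_clopen i].
Qed.

Lemma stone_space_clopen_base : has_clopen_base stone_space.
Proof.
exists (range stone_set); last by move=> _ [a _ <-]; exact: stone_set_clopen.
split; first by move=> _ [a _ <-]; have [] := stone_set_clopen a.
move=> u U /stone_nbhsP[a ua aU]; by exists (stone_set a).
Qed.

(** An element in [u] but not in [v] would separate the two points by a stone set and its
    complement. This gives one inclusion, and passing to complements gives the other. *)
Lemma stone_space_hausdorff : hausdorff_space stone_space.
Proof.
move=> u v uv; apply: sig_inj.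
have sub a : sval u a -> sval v a.
  move=> ua; apply: contrapT => /(boolean_ultrafilterC (svalP v).1) va.
  have [||w [wa]] := uv (stone_set a) (stone_set (~` a)%O).
  - by apply/stone_nbhsP; exists a.
  - by apply/stone_nbhsP; exists (~` a)%O.
  - by rewrite stone_setC.
apply/seteqP; split=> // a va; apply: contrapT.
move=> /(boolean_ultrafilterC (svalP u).1)/sub.
by move=> /(boolean_ultrafilterC (svalP v).1).
Qed.

Definition stone_pzlc : pzlc_space :=
  PZLCSpace stone_space_locally_compact stone_space_clopen_base
    stone_space_hausdorff.

(** Every point meets [I], so the sets [stone_set i] with [i] in [I] cover the space; they are
    directed because [I] is closed under joins. *)
Lemma stone_compact_cover (C : set stone_space) : compact C ->
  exists2 i, I i & C `<=` stone_set i.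
Proof.
have [[[_ I0 _ IU] _] _] := zlbaP A.
move=> Cc; apply: (compact_directed_cover Cc) => //.
  by move=> i j Ii Ij; exists (i `|` j)%O; [exact: IU|rewrite stone_setU].
move=> u _; have [_ [i Ii ui]] := svalP u; exists i => //.
by apply/stone_nbhsP; exists i.
Qed.

Lemma stone_set_compact_ideal a : compact (stone_set a) -> I a.
Proof.
have [[[_ _ IS _] _] _] := zlbaP A.
by move=> /stone_compact_cover[i Ii /stone_set_subset]; exact: IS.
Qed.

Lemma stone_set_surj (U : set stone_space) : clopen U ->
  exists a, stone_set a = U.
Proof.
move=> [Uop Ucl]; have [[[_ [i0 Ii0] IS IU] _] lub] := zlbaP A.
have {}IS i j : I j -> (i <= j)%O -> I i by exact: IS.
pose J := [set i | I i /\ stone_set i `<=` U].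
have Jideal : ideal_of I J.
  split; first by move=> i [].
  - exists \bot%O; split; first exact: IS Ii0 (le0x _).
    by rewrite stone_set0.
  - move=> a b Ia [Ib bU] ab; split=> //.
    by apply: subset_trans bU; exact/stone_set_subset.
  - move=> a b [Ia aU] [Ib bU]; split; first exact: IU.
    by rewrite stone_setU subUset.
have Jcov u : U u -> exists2 i, J i & sval u i.
  move=> /Uop[a ua aU]; have [uu [i Ii ui]] := svalP u.
  exists (a `&` i)%O; last exact/(boolean_ultrafilterI uu).
  split; first exact: IS Ii (leIr _ _).
  by rewrite stone_setI; exact: subset_trans (@subIsetl _ _ _) aU.
have Jsimple : simple_ideal I J.
  split=> // a Ia; have [_ J0 _ JU] := Jideal.
  (* Since [U] is closed, its trace on [stone_set a] is compact, hence inside [stone_set b] for a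
     single [b] in [J]. Splitting [a] along [b] then gives the decomposition: the part of [a]
     outside [b] lies off [U], so it is disjoint from all of [J]. *)
  have [|||u [_ Uu]|b [Ib bU] aUb] := @compact_directed_cover _ _ J stone_set
    (stone_set a `&` U).
  - by apply: compact_closedI => //; exact: stone_set_compact.
  - exact: J0.
  - move=> i j Ji Jj; exists (i `|` j)%O; first exact: JU.
    by rewrite stone_setU.
  - by have [i Ji ui] := Jcov u Uu; exists i => //; apply/stone_nbhsP; exists i.
  exists (a `&` b)%O, (a `&` ~` b)%O; split.
  - split; first exact: IS Ia (leIl _ _).
    by rewrite stone_setI; exact: subset_trans (@subIsetr _ _ _) bU.
  - split; first exact: IS Ia (leIl _ _).
    move=> c [_ cU]; apply: stone_set_inj.
    rewrite !stone_setI stone_setC stone_set0 -subset0 => u [[ua nub] /cU Uu].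
    by apply: nub; exact: aUb.
  - by rewrite -meetUr joinxC meetx1.
have [m [mub mleast]] := lub J Jsimple; exists m.
apply/seteqP; split=> u.
  (* A point of [stone_set m] contains some [i] in [I], which splits as [b] in [J] joined with [c]
     disjoint from [J]. The complement of [c] bounds [J] above, hence lies above [m], so the point
     cannot contain [c]; it contains [b] and lies in [U]. *)
  move=> um; have [uu [i Ii ui]] := svalP u.
  have [b [c [Jb [_ Jc] iE]]] := Jsimple.2 i Ii.
  move: ui; rewrite iE => /(boolean_ultrafilterU uu)[ub|uc]; first exact: Jb.2.
  have : (m <= ~` c)%O.
    by apply: mleast => e /Jc ce; rewrite -disj_leC meetC ce.
  by move=> /(boolean_ultrafilter_le uu)/(_ um)/(boolean_ultrafilterC uu).
by move=> /Jcov[i /mub im]; exact: (boolean_ultrafilter_le (svalP u).1 im).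
Qed.

End StoneSpace.

(** * The functor from algebras to spaces *)

Section StoneMap.
Variables (A B : zlba) (phi : A -> B).
Hypothesis phiP : pzlba_hom phi.

(** Condition (LBA) is what makes the pulled-back ultrafilter meet the ideal of [A]. *)
Lemma stone_map_subproof (u : stone_space B) :
  boolean_ultrafilter (phi @^-1` sval u) /\
  exists2 i, @zlba_ideal A i & sval u (phi i).
Proof.
have [[phi0 _ phiI _ phiC] phiL _] := phiP.
have [uu [j Jj uj]] := svalP u.
split; last by have [i Ii ji] := phiL j Jj; exists i => //;
  exact: (boolean_ultrafilter_le uu ji).
split; last by move=> a; rewrite /preimage/= phiC; exact: uu.2.
split.
- by rewrite /preimage/= phi0; exact: (boolean_ultrafilter0 uu).
- move=> a b ua /meet_l ab; apply: (boolean_ultrafilter_le uu _ ua).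
  by rewrite leEmeet -phiI ab.
- move=> a b ua ub; rewrite /preimage/= phiI.
  exact/(boolean_ultrafilterI uu).
Qed.

Definition stone_map (u : stone_space B) : stone_space A :=
  exist _ (phi @^-1` sval u) (stone_map_subproof u).

Lemma stone_map_continuous : continuous stone_map.
Proof.
move=> u U /stone_nbhsP[a ua aU]; apply/stone_nbhsP.
by exists (phi a) => // v va; exact: aU.
Qed.

(** The preimage of [stone_set i] is [stone_set (phi i)], which is compact for [i] in the ideal by
    (PLBA). Fibres are closed in such sets. *)
Lemma stone_map_perfect : perfect_map stone_map.
Proof.
have [_ _ phiP'] := phiP.
have sc := stone_map_continuous.
split=> // [C Ccl v vC|v].
  (* Near [v] only the part of [C] over [stone_set i] matters; its image is compact, hence closed in
     the Hausdorff space of [A]. *)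
  have [_ [i Ii vi]] := svalP v.
  have fcompact : compact (stone_map @` (C `&` stone_set (phi i))).
    apply: continuous_image_compact => //; rewrite setIC.
    by apply: compact_closedI => //; exact/stone_set_compact/phiP'.
  suff [u [Cu _] <-] : (stone_map @` (C `&` stone_set (phi i))) v by exists u.
  apply: (compact_closed (@stone_space_hausdorff A) fcompact) => U vU.
  have [|_ [[u Cu <-] [Uu ui]]] := vC (U `&` stone_set i).
    by apply: filterI => //; apply/stone_nbhsP; exists i.
  by exists (stone_map u); split=> //; exists u.
have [_ [i Ii vi]] := svalP v.
apply: (subclosed_compact _ (stone_set_compact (phiP' i Ii))).
  apply: preimage_closed => [u _|]; first exact: sc.
  exact: compact_closed (@stone_space_hausdorff A) (@compact_set1 _ v).
by move=> u uv; move: vi; rewrite -uv.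
Qed.

End StoneMap.

Definition stone_functor : functor (opposite PZLBA) PZLC.
Proof.
exists (fun A : opposite PZLBA => stone_pzlc A : PZLC)
  (fun A B phi => exist _ _ (stone_map_perfect (svalP phi))).
- by move=> A; apply: sig_inj; apply/funext => u; exact: sig_inj.
- by move=> A B C psi phi; apply: sig_inj; apply/funext => u; exact: sig_inj.
Defined.

(** * Every space is naturally homeomorphic to the Stone space of its clopen algebra *)

Section StoneUnit.
Variable X : pzlc_space.

Local Notation CO := (clopen_zlba X).

Lemma clopens_at_subproof (x : X) :
  boolean_ultrafilter [set U : CO | sval U x] /\
  exists2 K, @zlba_ideal CO K & sval K x.
Proof.
split; last first.
  have [K [Kcl Kc Kx _]] := compact_clopen_nbhs (@filterT _ _ (nbhs_filter x)).
  by exists (exist _ K Kcl).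
split; last by move=> U; exact: EM.
by split=> // U V Ux /clopens_leP; exact.
Qed.

Definition clopens_at (x : X) : stone_space CO :=
  exist _ [set U : CO | sval U x] (clopens_at_subproof x).

(** The members of [u] generate a proper filter containing the compact set [K], so it has a cluster
    point [x]. Members of [u] are closed, hence contain [x]; conversely, a clopen set around [x] is
    in [u], since otherwise its complement would be. *)
Lemma clopens_at_surj (u : stone_space CO) : exists x, clopens_at x = u.
Proof.
have [uu [K Kc uK]] := svalP u.
pose F := filter_from (sval u) (fun U : CO => sval U).
have FF : ProperFilter F.
  apply: filter_from_proper => [|U uU].
    apply: filter_from_filter => [|U V uU uV]; first by exists K.
    by exists (U `&` V)%O => //; exact/(boolean_ultrafilterI uu).
  apply: contrapT => /nonemptyPn U0; apply: (boolean_ultrafilter0 uu).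
  by rewrite (_ : \bot%O = U)//; exact: sig_inj.
have [|x [_ Fx]] := Kc F FF; first by exists K.
have ux (U : CO) : sval u U -> sval U x.
  by move=> uU; apply: (svalP U).2 => V Vx; apply: Fx Vx; exists U.
exists x; apply: sig_inj; apply/seteqP; split=> U /=; last exact: ux.
by move=> Ux; apply: contrapT => /(boolean_ultrafilterC uu)/ux.
Qed.

(** A clopen [K] around [x] inside [U] also contains [y], so [y] itself shows that any
    neighbourhoods [U] of [x] and [V] of [y] meet. *)
Lemma clopens_at_inj : injective clopens_at.
Proof.
move=> x y /(congr1 sval)/= xy; apply: space_haus => U V xU yV.
have [K [Kcl _ Kx KU]] := compact_clopen_nbhs xU.
exists y; split; last exact: nbhs_singleton.
apply: KU; have : [set W : CO | sval W x] (exist _ K Kcl) by [].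
by rewrite xy.
Qed.

Definition clopens_point (u : stone_space CO) : X :=
  sval (cid (clopens_at_surj u)).

Lemma clopens_pointK : cancel clopens_point clopens_at.
Proof. by move=> u; rewrite /clopens_point; case: cid. Qed.

Lemma clopens_atK : cancel clopens_at clopens_point.
Proof. by move=> x; apply: clopens_at_inj; rewrite clopens_pointK. Qed.

Lemma clopens_at_continuous : continuous clopens_at.
Proof.
move=> x W /stone_nbhsP[U Ux UW].
by apply: filterS (open_nbhs_nbhs (conj (svalP U).1 Ux)) => y Uy; exact: UW.
Qed.

Lemma clopens_point_continuous : continuous clopens_point.
Proof.
move=> u W /compact_clopen_nbhs[K [Kcl _ Ku KW]].
apply/stone_nbhsP; exists (exist _ K Kcl); first by rewrite -[u]clopens_pointK.
by move=> v vK; apply: KW; rewrite -[v]clopens_pointK in vK.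
Qed.

Lemma clopens_at_perfect : perfect_map (clopens_at : X -> stone_pzlc CO).
Proof.
exact: homeomorphism_perfect clopens_at_continuous clopens_point_continuous
  clopens_atK clopens_pointK.
Qed.

Lemma clopens_point_perfect : perfect_map (clopens_point : stone_pzlc CO -> X).
Proof.
exact: homeomorphism_perfect clopens_point_continuous clopens_at_continuous
  clopens_pointK clopens_atK.
Qed.

End StoneUnit.

Lemma clopen_stone_iso :
  naturally_isomorphic (comp_functor stone_functor clopen_functor)
    (id_functor PZLC).
Proof.
exists (fun X : PZLC => exist _ _ (clopens_point_perfect X)); split=> [X|X Y f].
  exists (exist _ _ (clopens_at_perfect X)); split; apply: sig_inj.
    by apply/funext => u /=; exact: clopens_pointK.
  by apply/funext => x /=; exact: clopens_atK.
(* Writing [u] as [clopens_at] of its point and applying the injective [clopens_at] reduces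
   naturality of the inverse to that of [clopens_at], where both sides contain the same clopen sets
   by definition. *)
apply: sig_inj; apply/funext => u /=; rewrite -{1}[u]clopens_pointK.
by apply: clopens_at_inj; rewrite clopens_pointK; exact: sig_inj.
Qed.

(** * Every ZLBA is naturally isomorphic to the clopen algebra of its Stone space *)

Section StoneCounit.
Variable A : zlba.

Definition stone_clopen (a : A) : clopen_zlba (stone_pzlc A) :=
  exist _ _ (stone_set_clopen a).

Lemma stone_clopen_surj U : exists a, stone_clopen a = U.
Proof.
by have [a aU] := stone_set_surj (svalP U); exists a; exact: sig_inj.
Qed.

Definition clopen_stone U : A := sval (cid (stone_clopen_surj U)).

Lemma clopen_stoneK : cancel clopen_stone stone_clopen.
Proof. by move=> U; rewrite /clopen_stone; case: cid. Qed.

Lemma stone_clopenK : cancel stone_clopen clopen_stone.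
Proof.
move=> a; apply: stone_set_inj.
by rewrite -[LHS]/(sval (stone_clopen _)) clopen_stoneK.
Qed.

Lemma stone_clopen_boolean_hom : boolean_hom stone_clopen.
Proof.
split=> *; apply: sig_inj => /=.
- exact: stone_set0.
- exact: stone_set1.
- exact: stone_setI.
- exact: stone_setU.
- exact: stone_setC.
Qed.

Lemma stone_clopen_pzlba_hom : pzlba_hom stone_clopen.
Proof.
split; first exact: stone_clopen_boolean_hom.
  move=> U /stone_compact_cover[i Ii Ui].
  by exists i => //; exact/clopens_leP.
by move=> i; exact: stone_set_compact.
Qed.

(** The Boolean laws transfer along the bijection [stone_clopen]; (PLBA) holds because [stone_set a]
    is compact only for [a] in the ideal. *)
Lemma clopen_stone_pzlba_hom : pzlba_hom clopen_stone.
Proof.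
have [s0 s1 sI sU sC] := stone_clopen_boolean_hom.
have inj := can_inj stone_clopenK.
split.
    by split=> *; apply: inj; rewrite ?(s0, s1, sI, sU, sC) !clopen_stoneK.
  move=> i Ii; exists (stone_clopen i); last by rewrite stone_clopenK.
  exact: stone_set_compact.
move=> U Uc; apply: stone_set_compact_ideal.
by rewrite -[stone_set _]/(sval (stone_clopen _)) clopen_stoneK.
Qed.

End StoneCounit.

Lemma stone_clopen_iso :
  naturally_isomorphic (comp_functor clopen_functor stone_functor)
    (id_functor (opposite PZLBA)).
Proof.
(* Arrows are reversed in the opposite category, so the component towards [A] is the homomorphism
   [stone_clopen] out of [A]. *)
exists (fun A : opposite PZLBA => exist _ _ (stone_clopen_pzlba_hom A)).
split=> [A|A B phi]; last by apply: sig_inj; apply/funext => b; exact: sig_inj.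
exists (exist _ _ (clopen_stone_pzlba_hom A)); split; apply: sig_inj.
  by apply/funext => U /=; exact: clopen_stoneK.
by apply/funext => a /=; exact: stone_clopenK.
Qed.

Theorem theorem1p21 : dually_equivalent PZLC PZLBA.
Proof.
exists clopen_functor, stone_functor.
by split; [exact: clopen_stone_iso|exact: stone_clopen_iso].
Qed.
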